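(* Consider the affiliation submodels (Aff-m) and (Aff) of the hypergraph stochastic blockmodel with $Q$ groups, $n$ nodes and largest hyperedge size $M$, and an observed hypergraph $Y$. Given variational parameters $(\tau_{iq})_{i,q}$ at any iteration of the variational EM algorithm, the corresponding optimal values of $(\widehat\alpha^{(m)},\widehat\beta^{(m)})_m$ and of $\widehat\alpha,\widehat\beta$, respectively, maximizing $\theta\mapsto\mathcal J(\theta,\tau)$ (subject to $\sum_q\pi_q=1$) are given as follows. (1) Under (Aff-m), $$\widehat\alpha^{(m)}=\frac{\sum_{q=1}^Q\sum_{i_1<\dots<i_m}\tau_{i_1q}\cdots\tau_{i_mq}\,Y_{i_1,\dots,i_m}}{\sum_{q=1}^Q\sum_{i_1<\dots<i_m}\tau_{i_1q}\cdots\tau_{i_mq}},$$ $$\widehat\beta^{(m)}=\frac{\sum_{\substack{q_1\le\dots\le q_m\\ |\{q_1,\dots,q_m\}|\ge2}}\ \sum_{(i_1,\dots,i_m)\in\mathcal V^m}\tau_{i_1q_1}\cdots\tau_{i_mq_m}\,Y_{i_1,\dots,i_m}}{\sum_{\substack{q_1\le\dots\le q_m\\ |\{q_1,\dots,q_m\}|\ge2}}\ \sum_{(i_1,\dots,i_m)\in\mathcal V^m}\tau_{i_1q_1}\cdots\tau_{i_mq_m}}.$$ (2) Under (Aff), $$\widehat\alpha=\frac{\sum_{m=2}^M\sum_{q=1}^Q\sum_{i_1<\dots<i_m}\tau_{i_1q}\cdots\tau_{i_mq}\,Y_{i_1,\dots,i_m}}{\sum_{m=2}^M\sum_{q=1}^Q\sum_{i_1<\dots<i_m}\tau_{i_1q}\cdots\tau_{i_mq}},$$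 $$\widehat\beta=\frac{\sum_{m=2}^M\ \sum_{\substack{q_1\le\dots\le q_m\\ |\{q_1,\dots,q_m\}|\ge2}}\ \sum_{(i_1,\dots,i_m)\in\mathcal V^m}\tau_{i_1q_1}\cdots\tau_{i_mq_m}\,Y_{i_1,\dots,i_m}}{\sum_{m=2}^M\ \sum_{\substack{q_1\le\dots\le q_m\\ |\{q_1,\dots,q_m\}|\ge2}}\ \sum_{(i_1,\dots,i_m)\in\mathcal V^m}\tau_{i_1q_1}\cdots\tau_{i_mq_m}}.$$
   Context: Nodes are $\mathcal V=\{1,\dots,n\}$. $\mathcal V^m$ is the set of (ordered) tuples $(i_1,\dots,i_m)$ of $m$ distinct nodes; group indices $q,q_1,\dots,q_m$ range over $\{1,\dots,Q\}$ and, in sums over $i_1<\dots<i_m$, the indices range over $\{1,\dots,n\}$. A simple hypergraph with hyperedge sizes between $2$ and $M$ is encoded by indicators $Y_{i_1,\dots,i_m}\in\{0,1\}$, one for each subset $\{i_1,\dots,i_m\}$ of $m$ distinct nodes, $2\le m\le M$ (the value does not depend on the order of the indices). Hypergraph stochastic blockmodel with parameter $\theta=(\pi_q,B^{(m)}_{q_1,\dots,q_m})$: $Z_1,\dots,Z_n$ are i.i.d. latent variables in $\{1,\dots,Q\}$ with $\mathbb P_\theta(Z_i=q)=\pi_q$, $\pi_q\ge 0$, $\sum_q\pi_q=1$; given $Z=(Z_1,\dots,Z_n)$ the indicators are independent, $Y_{i_1,\dots,i_m}$ being Bernoulli with parameter $B^{(m)}_{Z_{i_1},\dots,Z_{i_m}}\in[0,1]$,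 each tensor $B^{(m)}$ being fully symmetric. Submodel (Aff-m): for each $m$, $B^{(m)}_{q_1,\dots,q_m}=\alpha^{(m)}$ if $q_1=\dots=q_m$, and $B^{(m)}_{q_1,\dots,q_m}=\beta^{(m)}$ if at least two of the $q_i$ differ. Submodel (Aff): for all $m=2,\dots,M$, $B^{(m)}_{q_1,\dots,q_m}=\alpha$ if $q_1=\dots=q_m$, and $=\beta$ if at least two of the $q_i$ differ, with $\alpha,\beta$ not depending on $m$. The variational parameters satisfy $\tau_{iq}\in[0,1]$ and $\sum_q\tau_{iq}=1$ for every $i$; $\mathbb Q_\tau$ is the distribution on $\{1,\dots,Q\}^n$ under which $Z_1,\dots,Z_n$ are independent with $\mathbb Q_\tau(Z_i=q)=\tau_{iq}$. With $f(y,b)=y\log b+(1-y)\log(1-b)$, the evidence lower bound is defined, and written out, as $$\mathcal J(\theta,\tau)=\mathbb E_{\mathbb Q_\tau}[\log\mathbb P_\theta(Y,Z)]-\mathbb E_{\mathbb Q_\tau}[\log\mathbb Q_\tau(Z)]$$ $$=\sum_{q=1}^Q\sum_{i=1}^n\tau_{iq}\log\frac{\pi_q}{\tau_{iq}}+\sum_{m=2}^M\ \sum_{q_1\le\dots\le q_m}\ \sum_{(i_1,\dots,i_m)\in\mathcal V^m}\tau_{i_1q_1}\cdots\tau_{i_mq_m}\,f\big(Y_{i_1,\dots,i_m},B^{(m)}_{q_1,\dots,q_m}\big).$$ The variational EM algorithm alternates maximization of $\mathcal J$ in $\tau$ (for the current $\theta$) and in $\theta$ (for the current $\tau$).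
   Formalization: In the β formulas the sum over V^m lists nodes sharing a group in increasing order, so each labelled node subset counts once; with all ordered tuples the formulas fail for J as defined. Values are claimed unique only where the denominator is nonzero. *)

(* Defs.v *)
From HB Require Import structures.
From mathcomp Require Import all_boot all_order all_algebra.
From mathcomp Require Import all_classical all_reals all_analysis.

Set Implicit Arguments.
Unset Strict Implicit.
Unset Printing Implicit Defensive.

Import Order.TTheory GRing.Theory Num.Theory.
Local Open Scope ring_scope.

(* Nodes and groups are numbered from 0.  [Y e] is the indicator of the
   hyperedge with node set [e]; only sets of size between 2 and [M] are ever
   looked at, which makes the hypergraph simple and [Y] insensitive to the
   order of the nodes. *)
Definition hypergraph (n : nat) := {set 'I_n} -> bool.

Section Model.
Context {R : realType} {n Q : nat}.

Record hsbm_param := HSBM {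
  prior : 'I_Q -> R;
  conn : forall m, m.-tuple 'I_Q -> R
}.

Definition hsbm_valid (M : nat) (th : hsbm_param) : Prop :=
  [/\ forall q, 0 <= prior th q,
      \sum_q prior th q = 1,
      forall m, (2 <= m <= M)%N ->
        forall q : m.-tuple 'I_Q, 0 <= conn th q <= 1
    & forall m, (2 <= m <= M)%N ->
        forall q q' : m.-tuple 'I_Q, perm_eq q q' -> conn th q = conn th q'].

Definition increasing m (i : m.-tuple 'I_n) : bool :=
  sorted ltn [seq val x | x <- i].

(* P_theta(Y, Z = z): a subset of m nodes is represented by its increasing
   enumeration, and only hyperedge sizes m between 2 and [M] enter. *)
Definition joint_lik (M : nat) (Y : hypergraph n) (th : hsbm_param)
    (z : {ffun 'I_n -> 'I_Q}) : R :=
  (\prod_i prior th (z i)) *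
  \prod_(2 <= m < M.+1) \prod_(i : m.-tuple 'I_n | increasing i)
    bernoulli_pmf (conn th (map_tuple z i)) (Y [set x in i]).

Definition variational (tau : 'I_n -> 'I_Q -> R) : Prop :=
  (forall i q, 0 <= tau i q <= 1) /\ (forall i, \sum_q tau i q = 1).

Definition qlaw (tau : 'I_n -> 'I_Q -> R) (z : {ffun 'I_n -> 'I_Q}) : R :=
  \prod_i tau i (z i).

Definition qexpect (tau : 'I_n -> 'I_Q -> R)
    (X : {ffun 'I_n -> 'I_Q} -> \bar R) : \bar R :=
  (\sum_z (qlaw tau z)%:E * X z)%E.

(* The logarithm is extended-real valued, with [lne 0 = -oo] and
   [0 * -oo = 0]; the second expectation is always finite. *)
Definition elbo (M : nat) (Y : hypergraph n) (tau : 'I_n -> 'I_Q -> R)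
    (th : hsbm_param) : \bar R :=
  (qexpect tau (fun z => lne (joint_lik M Y th z)%:E)
   - qexpect tau (fun z => lne (qlaw tau z)%:E))%E.

Definition affiliation_values (M : nat) (th : hsbm_param)
    (alpha beta : nat -> R) : Prop :=
  forall m, (2 <= m <= M)%N -> forall q : m.-tuple 'I_Q,
    conn th q = if constant q then alpha m else beta m.

Definition aff_m (M : nat) (th : hsbm_param) : Prop :=
  hsbm_valid M th /\
  exists alpha beta : nat -> R, affiliation_values M th alpha beta.

Definition aff (M : nat) (th : hsbm_param) : Prop :=
  hsbm_valid M th /\
  exists alpha beta : R,
    affiliation_values M th (fun=> alpha) (fun=> beta).

Definition maximizes (D : hsbm_param -> Prop) (J : hsbm_param -> \bar R)
    (th : hsbm_param) : Prop :=
  D th /\ forall th', D th' -> (J th' <= J th)%E.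

Definition nondecreasing_groups m (q : m.-tuple 'I_Q) : bool :=
  sorted leq [seq val x | x <- q].

(* Range of the inner sum in
     \sum_(q_1 <= ... <= q_m) \sum_((i_1, ..., i_m) in V^m).
   A tuple of distinct nodes is taken up to the permutations of positions
   that fix (q_1, ..., q_m): nodes sharing a group are listed increasingly.
   The double sum thus runs once over each m-subset of nodes equipped with a
   group label on each of its nodes, which is what is needed for
     \sum_(q_1 <= ... <= q_m) \sum_((i_1, ..., i_m) in V^m)
       tau_(i_1 q_1) ... tau_(i_m q_m) f(Y_(i_1 ... i_m), B_(q_1 ... q_m))
   to be the size-m contribution to the evidence lower bound.  Without this
   convention, a labelled subset whose groups have multiplicities
   c_1, c_2, ... would be counted c_1! c_2! ... times. *)
Definition node_tuple m (q : m.-tuple 'I_Q) (i : m.-tuple 'I_n) : bool :=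
  uniq i &&
  [forall k : 'I_m, forall l : 'I_m,
     (k < l)%N && (tnth q k == tnth q l) ==> (tnth i k < tnth i l)%N].

Definition alpha_num (Y : hypergraph n) (tau : 'I_n -> 'I_Q -> R) (m : nat) : R :=
  \sum_(q < Q) \sum_(i : m.-tuple 'I_n | increasing i)
    (\prod_(k < m) tau (tnth i k) q) * (Y [set x in i])%:R.

Definition alpha_den (tau : 'I_n -> 'I_Q -> R) (m : nat) : R :=
  \sum_(q < Q) \sum_(i : m.-tuple 'I_n | increasing i)
    \prod_(k < m) tau (tnth i k) q.

Definition beta_num (Y : hypergraph n) (tau : 'I_n -> 'I_Q -> R) (m : nat) : R :=
  \sum_(q : m.-tuple 'I_Q |
        nondecreasing_groups q && (2 <= #|[set x in q]|)%N)
    \sum_(i : m.-tuple 'I_n | node_tuple q i)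
      (\prod_(k < m) tau (tnth i k) (tnth q k)) * (Y [set x in i])%:R.

Definition beta_den (tau : 'I_n -> 'I_Q -> R) (m : nat) : R :=
  \sum_(q : m.-tuple 'I_Q |
        nondecreasing_groups q && (2 <= #|[set x in q]|)%N)
    \sum_(i : m.-tuple 'I_n | node_tuple q i)
      \prod_(k < m) tau (tnth i k) (tnth q k).

End Model.

Arguments hsbm_param : clear implicits.

(* Main.v *)
(* Expanding the expectation, and up to the entropy of Q_tau, the lower bound
   is a sum of terms  \sum_k w_k ln x_k  with x a probability vector: one for
   the prior, and, for each hyperedge size and each of the two classes
   "constant labels" / "non-constant labels", a two-term one with
   x = (v, 1 - v), where w_k is the expected number of node sets of that class
   with, respectively without, a hyperedge.  Gibbs' inequality says that each
   is maximal, uniquely unless w = 0, at x_k = w_k / \sum w.  Under (Aff) the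
   weights are first summed over the sizes.  Parameters giving probability 0
   to some (Y, z) with Q_tau(z) > 0 have lower bound -oo and never win. *)
Require Import Defs.
From HB Require Import structures.
From mathcomp Require Import all_boot all_order all_algebra.
From mathcomp Require Import all_classical all_reals all_analysis.
From mathcomp Require Import ring lra.
Set Implicit Arguments.
Unset Strict Implicit.
Unset Printing Implicit Defensive.

Import Order.TTheory GRing.Theory Num.Theory.
Local Open Scope ring_scope.

(** * Gibbs' inequality with its equality case *)

Section Likelihood.
Context {R : realType}.

Lemma ltr_ln_subr1 (t : R) : 0 < t -> t != 1 -> ln t < t - 1.
Proof.
move=> t0 t1; rewrite ltrBrDl -{2}(lnK t0); apply: expR_gt1Dx.
by rewrite ln_eq0.
Qed.

(** This is [ln t <= t - 1] at [t = x / (w / W)], multiplied by [w], with equality only at [t = 1];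
    for [w = 0] it reduces to [0 <= W * x]. When [W] is the total weight and [x] a probability
    vector, the upper bounds [W * x - w] sum to 0. *)
Lemma gibbs_term (W w x : R) : 0 < W -> 0 <= w -> 0 <= x -> (0 < w -> 0 < x) ->
  w * ln x - w * ln (w / W) <= W * x - w ?= iff (W * x == w).
Proof.
move=> W0; rewrite le0r => /predU1P[-> x0 _|w0 _ /(_ w0) x0].
  rewrite !mul0r !subr0; split; first by rewrite mulr_ge0 // ltW.
  by rewrite eq_sym.
have t0 : 0 < x / (w / W) by rewrite ?divr_gt0.
rewrite -mulrBr -ln_div ?posrE ?divr_gt0 //.
have eqt : W * x - w = w * (x / (w / W) - 1).
  by field; rewrite ?gt_eqF // lt0r_neq0.
have eqb : (W * x == w) = (x / (w / W) == 1).
  rewrite -subr_eq0 eqt mulf_eq0 (gt_eqF w0) /= subr_eq0 //.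
rewrite eqt eqb; have [->|tN1] := eqVneq (x / (w / W)) 1.
  by rewrite ln1 subrr; split; rewrite ?lexx ?eqxx.
by apply/leifP; rewrite ltr_pM2l // ltr_ln_subr1.
Qed.

Lemma gibbs (K : finType) (w x : K -> R) (W := \sum_k w k) :
    (forall k, 0 <= w k) -> 0 < W ->
    (forall k, 0 <= x k) -> \sum_k x k = 1 -> (forall k, 0 < w k -> 0 < x k) ->
  \sum_k w k * ln (x k) <= \sum_k w k * ln (w k / W)
    ?= iff [forall k, W * x k == w k].
Proof.
move=> w0 W0 x0 x1 wx.
have := @leif_sum R K predT (fun k => W * x k == w k)
  (fun k => w k * ln (x k) - w k * ln (w k / W)) (fun k => W * x k - w k)
  (fun k _ => gibbs_term W0 (w0 k) (x0 k) (wx k)).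
rewrite !sumrB -mulr_sumr x1 mulr1 subrr => -[le0 eq0]; split.
  by rewrite -subr_le0.
by rewrite -subr_eq0 eq0.
Qed.

Definition bern_ll (w1 w0 v : R) : R := w1 * ln v + w0 * ln (1 - v).

(** Gibbs' inequality on two points. If both weights vanish, the function is identically 0 and every
    [v] is optimal, whence the implication in the equality case. *)
Lemma bern_ll_max (w1 w0 v : R) :
    0 <= w1 -> 0 <= w0 -> (0 < w1 + w0 -> 0 <= v <= 1) ->
    (0 < w1 -> 0 < v) -> (0 < w0 -> v < 1) ->
  bern_ll w1 w0 v <= bern_ll w1 w0 (w1 / (w1 + w0))
    ?= iff ((w1 + w0 != 0) ==> (v == w1 / (w1 + w0))).
Proof.
move=> w1p w0p v01 w1v w0v.
have [W0|WN0] := eqVneq (w1 + w0) 0.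
  have -> : w1 = 0 by apply/eqP; move/eqP: W0; rewrite paddr_eq0 // => /andP[].
  have -> : w0 = 0 by apply/eqP; move/eqP: W0; rewrite paddr_eq0 // => /andP[].
  by rewrite /bern_ll !mul0r addr0; split; rewrite ?eqxx.
have W0 : 0 < w1 + w0 by rewrite lt0r WN0 addr_ge0.
have /andP[v0 v1] := v01 W0.
have := @gibbs _ (fun b : bool => if b then w1 else w0)
  (fun b : bool => if b then v else 1 - v).
rewrite !big_bool /= => /(_ _ W0); rewrite big_bool /= => G.
have eqc : 1 - w1 / (w1 + w0) = w0 / (w1 + w0) by field.
rewrite /bern_ll eqc.
have -> : (v == w1 / (w1 + w0)) =
  [forall b : bool, (w1 + w0) * (if b then v else 1 - v) == if b then w1 else w0].
  apply/eqP/forallP => [-> []|/(_ true)/eqP E]; try by apply/eqP; field.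
  by rewrite -[in LHS](mulKf WN0 v) E mulrC.
apply: G; try by [ring | case; rewrite // ?subr_ge0].
by case; rewrite // subr_gt0.
Qed.

Lemma freq_bounds (w1 w0 : R) : 0 <= w1 -> 0 <= w0 -> 0 <= w1 / (w1 + w0) <= 1.
Proof.
move=> w1p w0p; have [->|WN0] := eqVneq (w1 + w0) 0.
  (* Since [x / 0 = 0], the candidate value of a class of zero weight still lies in [0, 1]. *)
  by rewrite invr0 mulr0 lexx ler01.
have W0 : 0 < w1 + w0 by rewrite lt0r WN0 addr_ge0.
by rewrite divr_ge0 ?addr_ge0 //= ler_pdivrMr // mul1r lerDl.
Qed.

(** Ensures that the candidate values give positive probability to every outcome of positive weight,
    so that their lower bound is finite. *)
Lemma bernoulli_freq_gt0 (w1 w0 : R) (y : bool) : 0 <= w1 -> 0 <= w0 ->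
  0 < (if y then w1 else w0) -> 0 < bernoulli_pmf (w1 / (w1 + w0)) y.
Proof.
move=> w1p w0p wy.
have W0 : 0 < w1 + w0 by case: y wy => ?; lra.
rewrite /bernoulli_pmf; case: y wy => wy; first by rewrite divr_gt0.
by rewrite subr_gt0 ltr_pdivrMr // mul1r ltrDl.
Qed.

Lemma ln_prod (I : eqType) (r : seq I) (P : pred I) (E : I -> R) :
    (forall i, i \in r -> P i -> 0 < E i) ->
  0 < \prod_(i <- r | P i) E i /\
  ln (\prod_(i <- r | P i) E i) = \sum_(i <- r | P i) ln (E i).
Proof.
move=> E0; rewrite big_seq_cond [X in _ = X]big_seq_cond.
apply: (big_ind2 (fun x y => 0 < x /\ ln x = y)) => [|x lx y ly [x0 <-] [y0 <-]|].
- by rewrite ltr01 ln1.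
- by rewrite mulr_gt0 // lnM.
- by move=> i /andP[ir Pi]; rewrite E0.
Qed.

Lemma prodr_gt0_factor (I : eqType) (r : seq I) (P : pred I) (E : I -> R) :
    (forall i, i \in r -> P i -> 0 <= E i) -> 0 < \prod_(i <- r | P i) E i ->
  forall i, i \in r -> P i -> 0 < E i.
Proof.
move=> E0 /lt0r_neq0; rewrite prodf_seq_neq0 => /allP EN0 i ir Pi.
by rewrite lt0r E0 // andbT; have := EN0 i ir; rewrite Pi.
Qed.

End Likelihood.

(** * Summing over subsets through sorted enumerations *)

Section SortedTuples.
Context {R : realType} {T : finType}.

(** Each [m]-subset has exactly one enumeration sorted by a given total order, and re-sorting is a
    bijection between the enumerations for the two orders. *)
Lemma sum_sorted_tuples (e1 e2 : rel T) (m : nat) (F : m.-tuple T -> R) :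
    total e1 -> transitive e1 -> antisymmetric e1 ->
    total e2 -> transitive e2 -> antisymmetric e2 ->
    (forall s t : m.-tuple T, perm_eq s t -> F s = F t) ->
  \sum_(s : m.-tuple T | uniq s && sorted e1 s) F s =
  \sum_(s : m.-tuple T | uniq s && sorted e2 s) F s.
Proof.
move=> tot1 tr1 anti1 tot2 tr2 anti2 Fperm.
have sortK e e' (s : m.-tuple T) : total e -> transitive e -> antisymmetric e ->
    sorted e s -> sort_tuple e (sort_tuple e' s) = s.
  move=> tot tr anti srt; apply: val_inj => /=.
  rewrite -[RHS](sorted_sort tr srt); apply/perm_sortP => //.
  by rewrite perm_sort.
rewrite (reindex_onto (sort_tuple e1) (sort_tuple e2)); last first.
  by move=> s /andP[_]; apply: sortK.
apply: eq_big => [s|s _]; last by apply: Fperm; rewrite /= perm_sort.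
rewrite /= sort_uniq sort_sorted // andbT; case: (uniq s) => //=.
apply/eqP/idP => [<-|]; first exact: sort_sorted.
exact: sortK.
Qed.

End SortedTuples.

(** * Marginals of the variational law *)

Section Marginals.
Context {R : realType} {n Q : nat} (tau : 'I_n -> 'I_Q -> R).
Hypothesis htau : variational tau.

Lemma qlaw_ge0 z : 0 <= qlaw tau z.
Proof. by apply: prodr_ge0 => i _; case: htau => /(_ i (z i))/andP[]. Qed.

Lemma qlaw_sum1 : \sum_z qlaw tau z = 1.
Proof.
by rewrite /qlaw -bigA_distr_bigA big1 // => i _; case: htau => _ /(_ i).
Qed.

(** Independence: the nodes of [i] are distinct, so each contributes its own factor, and the label
    probabilities of every other node sum to 1. *)
Lemma qlaw_marginal (m : nat) (i : m.-tuple 'I_n) (q : m.-tuple 'I_Q) : uniq i ->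
  \sum_(z : {ffun 'I_n -> 'I_Q} | map_tuple z i == q) qlaw tau z =
  \prod_(k < m) tau (tnth i k) (tnth q k).
Proof.
move=> ui; case: m i q ui => [|m] i q ui.
  rewrite big_ord0 -[RHS]qlaw_sum1; apply: eq_bigl => z.
  by rewrite (tuple0 (map_tuple _ _)) (tuple0 q) eqxx.
pose qq j := nth (tnth q ord0) q (index j i).
have qqE k : qq (tnth i k) = tnth q k.
  rewrite /qq (tnth_nth (tnth i ord0)) index_uniq ?size_tuple //.
  by rewrite -tnth_nth.
(* [qq j] is the label prescribed at node [j]; nodes outside [i] are unconstrained. The product of
   the [F j (z j)] is [qlaw tau z] on the event and 0 off it, and it can be summed one coordinate at
   a time. *)
pose F j c := if (j \in i) ==> (c == qq j) then tau j c else 0.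
transitivity (\sum_(z : {ffun 'I_n -> 'I_Q}) \prod_j F j (z j)).
  rewrite big_mkcond; apply: eq_bigr => z _; case: ifP => zq.
    apply: eq_bigr => j _; rewrite /F; case: ifPn => // /negP[].
    apply/implyP => /tnthP[k ->]; rewrite qqE -(eqP zq).
    by rewrite tnth_map.
  have [k kP] : exists k, z (tnth i k) != tnth q k.
    apply/existsP; rewrite -negb_forall; apply: contraFN zq => /forallP zq.
    by apply/eqP/eq_from_tnth => k; rewrite tnth_map (eqP (zq k)).
  rewrite (bigD1 (tnth i k)) //= {1}/F mem_tnth /= qqE (negbTE kP) mul0r.
  by [].
rewrite -bigA_distr_bigA (bigID (mem i)) /= [X in _ * X]big1 ?mulr1; last first.
  move=> j ji; rewrite /F (negbTE ji) /=; by case: htau => _ /(_ j).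
rewrite -big_uniq //= big_tuple; apply: eq_bigr => k _.
rewrite -qqE (bigD1 (qq (tnth i k))) //= big1 ?addr0.
  by rewrite /F eqxx implybT.
by move=> c cN; rewrite /F mem_tnth (negbTE cN).
Qed.

Lemma increasing_uniq m (i : m.-tuple 'I_n) :
  increasing i = uniq i && sorted (fun a b : 'I_n => (a <= b)%N) i.
Proof.
by rewrite /increasing ltn_sorted_uniq_leq (map_inj_uniq val_inj) sorted_map.
Qed.

Lemma constant_perm (T : eqType) (s t : seq T) : perm_eq s t -> constant s = constant t.
Proof.
have imp (u v : seq T) : perm_eq u v -> constant u -> constant v.
  case: v => // x v puv cu; apply: (@all_pred1_constant _ x).
  have /= := perm_all (pred1 x) puv => <-.
  case: u puv cu => [/perm_size//|y u puv /= cu].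
  have : x \in y :: u by rewrite (perm_mem puv) mem_head.
  rewrite inE => /predU1P[->|xu]; first by rewrite eqxx.
  by move/allP: (cu) => /(_ _ xu)/eqP->; rewrite eqxx.
by move=> p; apply/idP/idP; apply: imp => //; rewrite perm_sym.
Qed.

Lemma card_ge2_constant m (q : m.-tuple 'I_Q) :
  (2 <= #|[set x in q]|)%N = ~~ constant q.
Proof.
rewrite ltnNge; congr negb.
case: m q => [|m] q.
  by rewrite [q]tuple0 eq_card0 // => x; rewrite inE.
case: (tupleP q) => x s; apply/card_le1_eqP/idP => [H|/= /allP cs].
  apply: (@all_pred1_constant _ x); apply/allP => y yq /=.
  by apply/eqP; apply: H; rewrite inE // mem_head.
have xE y : y \in x :: s -> y = x.
  by rewrite inE => /predU1P[//|/cs/eqP].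
by move=> y z; rewrite !inE => /xE -> /xE ->.
Qed.

(* Listing a labelled set of nodes by group first and by node inside each
   group gives exactly the tuples that [beta_num] and [beta_den] sum over. *)
Definition group_order (z : {ffun 'I_n -> 'I_Q}) : rel 'I_n :=
  fun a b => (z a < z b)%N || ((z a == z b) && (a <= b)%N).

Lemma group_order_total z : total (group_order z).
Proof.
move=> a b; rewrite /group_order -!val_eqE /=.
by case: (ltngtP (z a) (z b)) => //= _; rewrite leq_total.
Qed.

Lemma group_order_trans z : transitive (group_order z).
Proof.
move=> b a c; rewrite /group_order -!val_eqE /=.
case: (ltngtP (z a) (z b)) => //= [ab _|->].
  case: (ltngtP (z b) (z c)) => //= [bc|<-] _; last by rewrite ab.
  by rewrite (ltn_trans ab bc).
by move=> ab; case: (ltngtP (z b) (z c)) => //= _; apply: leq_trans.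
Qed.

Lemma group_order_anti z : antisymmetric (group_order z).
Proof.
move=> a b; rewrite /group_order -!val_eqE /=.
by case: (ltngtP (z a) (z b)) => //= _ /anti_leq/val_inj.
Qed.

(** The order is lexicographic: its first key makes the labels nondecreasing, its second orders the
    nodes inside a group. Sortedness is made pairwise because [node_tuple] compares all pairs of
    positions. *)
Lemma node_tuple_group_order m (z : {ffun 'I_n -> 'I_Q}) (i : m.-tuple 'I_n) :
  nondecreasing_groups (map_tuple z i) && node_tuple (map_tuple z i) i =
  uniq i && sorted (group_order z) i.
Proof.
rewrite /node_tuple andbCA; case: (boolP (uniq i)) => //= ui.
case: m i ui => [|m] i ui.
  by rewrite [i]tuple0 /=; apply/forallP => -[].
pose x0 := tnth i ord0.
rewrite /nondecreasing_groups !sorted_map !sorted_pairwise; last first.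
- by move=> b a c /=; apply: leq_trans.
- exact: group_order_trans.
have nthE (k : nat) (km : (k < m.+1)%N) : nth x0 i k = tnth i (Ordinal km).
  by rewrite (tnth_nth x0).
apply/andP/(pairwiseP x0) => [[/(pairwiseP x0) nd /forallP lt] k l|srt].
  rewrite !inE size_tuple => km lm kl.
  rewrite /group_order; have := nd k l; rewrite !inE size_tuple /= => /(_ km lm kl).
  rewrite leq_eqVlt => /orP[zkl|->//]; apply/orP; right.
  rewrite -val_eqE zkl /= !nthE.
  have /forallP/(_ (Ordinal lm))/implyP := lt (Ordinal km).
  by rewrite /= kl !tnth_map -!nthE -val_eqE /= zkl => /(_ isT)/ltnW.
split.
  apply/(pairwiseP x0) => k l km lm kl; have := srt k l km lm kl.
  by rewrite /group_order /= => /orP[/ltnW//|/andP[/eqP-> _]].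
apply/forallP => k; apply/forallP => l; apply/implyP => /andP[kl].
rewrite !tnth_map => /eqP zkl.
have := srt k l; rewrite !inE size_tuple => /(_ (ltn_ord k) (ltn_ord l) kl).
(* [group_order] only gives a weak inequality inside a group; [uniq i] makes it strict. *)
rewrite -!tnth_nth /group_order zkl ltnn eqxx /= leq_eqVlt => /predU1P[/val_inj|//].
by rewrite !(tnth_nth x0) => /eqP; rewrite nth_uniq ?size_tuple // (ltn_eqF kl).
Qed.

(** The event of constant labels on [i] is the disjoint union, over [q], of the events that all
    labels are [q]. For [m = 0] these events coincide and the empty tuple would be counted [Q]
    times. *)
Lemma sum_constant_labels (g : {set 'I_n} -> R) (m : nat) : (0 < m)%N ->
  \sum_(q < Q) \sum_(i : m.-tuple 'I_n | increasing i)
     (\prod_(k < m) tau (tnth i k) q) * g [set x in i] =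
  \sum_(i : m.-tuple 'I_n | increasing i)
     (\sum_(z : {ffun 'I_n -> 'I_Q} | constant (map_tuple z i)) qlaw tau z) *
     g [set x in i].
Proof.
case: m => // m _.
rewrite exchange_big /=; apply: eq_bigr => i ii; rewrite -mulr_suml; congr (_ * _).
have ui : uniq i by move: ii; rewrite increasing_uniq => /andP[].
rewrite (partition_big (fun z : {ffun 'I_n -> 'I_Q} => z (tnth i ord0)) predT) //=.
apply: eq_bigr => q _.
transitivity (\prod_(k < m.+1) tau (tnth i k) (tnth (nseq_tuple m.+1 q) k)).
  by apply: eq_bigr => k _; rewrite tnth_nseq.
rewrite -qlaw_marginal //; apply: eq_bigl => z.
apply/eqP/andP => [E|[/constantP -/(_ q)[c cE] /eqP zq]].
  have E' : [seq z j | j <- i] = nseq m.+1 q := congr1 val E.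
  split; first by rewrite E' constant_nseq.
  have := congr1 (fun t => tnth t ord0) E; rewrite tnth_map => ->.
  by rewrite tnth_nseq.
apply: val_inj; rewrite /= cE size_tuple; congr nseq.
have := congr1 (fun s => nth q s 0) cE.
rewrite size_tuple (nth_map (tnth i ord0)) ?size_tuple //=.
by rewrite -(tnth_nth _ i ord0) zq => <-.
Qed.

(** Pairs [(q, i)] are expanded into pairs [(z, i)] where [q] lists the labels of [z] along [i]. For
    fixed [z], the tuples [i] are then the enumerations sorted by [group_order z], which can be
    traded for the increasing ones. *)
Lemma sum_nonconstant_labels (g : {set 'I_n} -> R) (m : nat) :
  \sum_(q : m.-tuple 'I_Q | nondecreasing_groups q && (2 <= #|[set x in q]|)%N)
    \sum_(i : m.-tuple 'I_n | node_tuple q i)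
      (\prod_(k < m) tau (tnth i k) (tnth q k)) * g [set x in i] =
  \sum_(i : m.-tuple 'I_n | increasing i)
     (\sum_(z : {ffun 'I_n -> 'I_Q} | ~~ constant (map_tuple z i)) qlaw tau z) *
     g [set x in i].
Proof.
pose F (z : {ffun 'I_n -> 'I_Q}) (i : m.-tuple 'I_n) :=
  (if constant (map_tuple z i) then 0 else qlaw tau z) * g [set x in i].
transitivity (\sum_z \sum_(i : m.-tuple 'I_n | uniq i && sorted (group_order z) i) F z i).
  under [RHS]eq_bigr => z _ do under eq_bigl => i do rewrite -node_tuple_group_order.
  under [LHS]eq_bigr => q _ do rewrite big_mkcond.
  under [RHS]eq_bigr => z _ do rewrite big_mkcond.
  rewrite [LHS]exchange_big [RHS]exchange_big /=; apply: eq_bigr => i _.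
  rewrite [RHS](partition_big (fun z : {ffun 'I_n -> 'I_Q} => map_tuple z i) predT) //=.
  rewrite big_mkcond; apply: eq_bigr => q _; rewrite card_ge2_constant.
  transitivity (\sum_(z : {ffun 'I_n -> 'I_Q} | map_tuple z i == q)
    if nondecreasing_groups q && ~~ constant q && node_tuple q i
    then qlaw tau z * g [set x in i] else 0).
    case: (nondecreasing_groups q && ~~ constant q); last by rewrite big1.
    rewrite /=; case: ifP => [/andP[ui _]|_]; last by rewrite big1.
    by rewrite -mulr_suml qlaw_marginal.
  apply: eq_bigr => z /eqP <-; rewrite /F.
  case: (nondecreasing_groups _) => //=; case: (constant _) => //=.
  by rewrite mul0r if_same.
transitivity (\sum_z \sum_(i : m.-tuple 'I_n | increasing i) F z i).
  apply: eq_bigr => z _; under [RHS]eq_bigl => i do rewrite increasing_uniq.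
  (* Applicable because [F z i] depends only on the set of nodes listed by [i]. *)
  apply: sum_sorted_tuples.
  - exact: group_order_total.
  - exact: group_order_trans.
  - exact: group_order_anti.
  - by move=> a b; apply: leq_total.
  - by move=> b a c; apply: leq_trans.
  - by move=> a b /anti_leq/val_inj.
  move=> s t st; rewrite /F (constant_perm (perm_map z st)); congr (_ * g _).
  by apply/finset.setP => x; rewrite !inE (perm_mem st).
rewrite exchange_big; apply: eq_bigr => i _; rewrite -mulr_suml; congr (_ * _).
by rewrite [RHS]big_mkcond; apply: eq_bigr => z _; case: (constant _).
Qed.

End Marginals.

(** * Reduction of the lower bound to weighted log-likelihoods *)

Section Bound.
Context {R : realType} {n Q : nat} (M : nat).
Context (Y : hypergraph n) (tau : 'I_n -> 'I_Q -> R).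
Hypothesis htau : variational tau.

(* [c] tells whether the node labels are all equal, [y] whether the hyperedge
   is present. *)
Definition weight (m : nat) (c y : bool) : R :=
  \sum_(i : m.-tuple 'I_n | increasing i && (Y [set x in i] == y))
    \sum_(z : {ffun 'I_n -> 'I_Q} | constant (map_tuple z i) == c) qlaw tau z.

Definition group_weight (q : 'I_Q) : R :=
  \sum_i \sum_(z : {ffun 'I_n -> 'I_Q} | z i == q) qlaw tau z.

Lemma weight_ge0 m c y : 0 <= weight m c y.
Proof. by do 2!(apply: sumr_ge0 => ? _); apply: qlaw_ge0. Qed.

Lemma group_weight_ge0 q : 0 <= group_weight q.
Proof. by do 2!(apply: sumr_ge0 => ? _); apply: qlaw_ge0. Qed.

(** Used with [f y = y] for the numerators, [f = 1] for the denominators, and log-probabilities for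
    the lower bound. *)
Lemma sum_weight m c (f : bool -> R) :
  \sum_(i : m.-tuple 'I_n | increasing i)
     (\sum_(z : {ffun 'I_n -> 'I_Q} | constant (map_tuple z i) == c) qlaw tau z)
     * f (Y [set x in i]) =
  weight m c true * f true + weight m c false * f false.
Proof.
rewrite (bigID (fun i : m.-tuple 'I_n => Y [set x in i])) /=.
rewrite /weight !mulr_suml; congr (_ + _); apply: eq_big => [i|i /andP[_ yi]].
- by rewrite eqb_id.
- by rewrite yi.
- by rewrite eqbF_neg.
- by rewrite (negbTE yi).
Qed.

Lemma alpha_numE m : (0 < m)%N -> alpha_num Y tau m = weight m true true.
Proof.
move=> m0; rewrite /alpha_num (sum_constant_labels htau (fun s => (Y s)%:R)) //.
under eq_bigr => i _ do under eq_bigl => z do rewrite -[constant _]eqb_id.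
by rewrite (sum_weight m true (fun y => y%:R)) mulr1 mulr0 addr0.
Qed.

Lemma alpha_denE m : (0 < m)%N ->
  alpha_den tau m = weight m true true + weight m true false.
Proof.
move=> m0; rewrite /alpha_den.
under eq_bigr => q _ do under eq_bigr => i _ do rewrite -[\prod_(_ < _) _]mulr1.
rewrite (sum_constant_labels htau (fun=> 1)) //.
under eq_bigr => i _ do under eq_bigl => z do rewrite -[constant _]eqb_id.
by rewrite (sum_weight m true (fun=> 1)) !mulr1.
Qed.

Lemma beta_numE m : beta_num Y tau m = weight m false true.
Proof.
rewrite /beta_num (sum_nonconstant_labels htau (fun s => (Y s)%:R)).
under eq_bigr => i _ do under eq_bigl => z do rewrite -[~~ _]eqbF_neg.
by rewrite (sum_weight m false (fun y => y%:R)) mulr1 mulr0 addr0.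
Qed.

Lemma beta_denE m : beta_den tau m = weight m false true + weight m false false.
Proof.
rewrite /beta_den.
under eq_bigr => q _ do under eq_bigr => i _ do rewrite -[\prod_(_ < _) _]mulr1.
rewrite (sum_nonconstant_labels htau (fun=> 1)) //.
under eq_bigr => i _ do under eq_bigl => z do rewrite -[~~ _]eqbF_neg.
by rewrite (sum_weight m false (fun=> 1)) !mulr1.
Qed.

Lemma expect_groups (f : 'I_Q -> R) :
  \sum_z qlaw tau z * \sum_i f (z i) = \sum_q group_weight q * f q.
Proof.
under eq_bigr => z _ do rewrite mulr_sumr.
under [RHS]eq_bigr => q _ do rewrite mulr_suml.
rewrite exchange_big [RHS]exchange_big; apply: eq_bigr => i _.
rewrite (partition_big (fun z : {ffun 'I_n -> 'I_Q} => z i) predT) //=.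
by apply: eq_bigr => q _; rewrite mulr_suml; apply: eq_bigr => z /eqP->.
Qed.

Lemma expect_edges m (f : bool -> bool -> R) :
  \sum_z qlaw tau z *
     (\sum_(i : m.-tuple 'I_n | increasing i)
        f (constant (map_tuple z i)) (Y [set x in i])) =
  (weight m true true * f true true + weight m true false * f true false) +
  (weight m false true * f false true + weight m false false * f false false).
Proof.
rewrite -!sum_weight -big_split /=.
under eq_bigr => z _ do rewrite mulr_sumr.
rewrite exchange_big; apply: eq_bigr => i _.
rewrite (bigID (fun z : {ffun 'I_n -> 'I_Q} => constant (map_tuple z i))) /=.
rewrite !mulr_suml; congr (_ + _); apply: eq_big => [z|z zi].
- by rewrite eqb_id.
- by rewrite zi.
- by rewrite eqbF_neg.
- by rewrite (negbTE zi).
Qed.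

Definition prior_compatible (p : 'I_Q -> R) : Prop :=
  forall z, 0 < qlaw tau z -> forall i, 0 < p (z i).

(** With [prior_compatible], this expresses finiteness of the lower bound. The range of [v] is
    imposed only on classes actually met: for [Q = 1] no tuple of groups is non-constant, so
    [affiliation_values] leaves [b m] arbitrary. *)
Definition compatible (a b : nat -> R) : Prop :=
  forall z, 0 < qlaw tau z -> forall m, (2 <= m <= M)%N ->
  forall i : m.-tuple 'I_n, increasing i ->
    let v := if constant (map_tuple z i) then a m else b m in
    0 <= v <= 1 /\ 0 < bernoulli_pmf v (Y [set x in i]).

Definition edge_ll (a b : nat -> R) : R :=
  \sum_(2 <= m < M.+1)
     (bern_ll (weight m true true) (weight m true false) (a m) +
      bern_ll (weight m false true) (weight m false false) (b m)).

Definition entropy_term : R := \sum_z qlaw tau z * ln (qlaw tau z).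

Lemma entropyE :
  qexpect tau (fun z => lne (qlaw tau z)%:E) = entropy_term%:E.
Proof.
rewrite /qexpect /entropy_term -sumEFin; apply: eq_bigr => z _.
have := qlaw_ge0 htau z; rewrite le0r => /predU1P[->|z0].
  by rewrite mul0e mul0r.
by rewrite lne_EFin.
Qed.

(** Every labelling of positive probability has positive likelihood, so its logarithm splits into
    real sums, whose expectations involve only the weights. *)
Lemma elbo_compatible th a b :
    affiliation_values M th a b -> prior_compatible (prior th) ->
    compatible a b ->
  elbo M Y tau th =
  (\sum_q group_weight q * ln (prior th q) + edge_ll a b - entropy_term)%:E.
Proof.
move=> thab cp cab; rewrite /elbo entropyE EFinB; congr (_ - _)%E.
have lik z : 0 < qlaw tau z -> 0 < joint_lik M Y th z /\
    ln (joint_lik M Y th z) = \sum_i ln (prior th (z i)) +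
      \sum_(2 <= m < M.+1) \sum_(i : m.-tuple 'I_n | increasing i)
        ln (bernoulli_pmf (if constant (map_tuple z i) then a m else b m)
              (Y [set x in i])).
  move=> z0; rewrite /joint_lik.
  have [p0 pE] := @ln_prod R _ (index_enum 'I_n) xpredT _
    (fun i _ _ => cp z z0 i).
  have F m : m \in index_iota 2 M.+1 ->
      0 < \prod_(i : m.-tuple 'I_n | increasing i)
        bernoulli_pmf (conn th (map_tuple z i)) (Y [set x in i]) /\
      ln (\prod_(i : m.-tuple 'I_n | increasing i)
        bernoulli_pmf (conn th (map_tuple z i)) (Y [set x in i])) =
      \sum_(i : m.-tuple 'I_n | increasing i)
        ln (bernoulli_pmf (if constant (map_tuple z i) then a m else b m)
              (Y [set x in i])).
    rewrite mem_index_iota ltnS => mM.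
    under [X in _ /\ _ = X]eq_bigr => i _ do rewrite -thab //.
    apply: ln_prod => i _ ii; rewrite thab //.
    by case: (cab z z0 m mM i ii).
  have [e0 eE] := @ln_prod R _ (index_iota 2 M.+1) xpredT _
    (fun m mM _ => (F m mM).1).
  split; first exact: mulr_gt0.
  rewrite lnM // pE eE; congr (_ + _); apply: eq_big_seq => m mM.
  by rewrite (F m mM).2.
rewrite /qexpect -(expect_groups (fun q => ln (prior th q))) /edge_ll.
transitivity ((\sum_z qlaw tau z * (\sum_i ln (prior th (z i)) +
      \sum_(2 <= m < M.+1) \sum_(i : m.-tuple 'I_n | increasing i)
        ln (bernoulli_pmf (if constant (map_tuple z i) then a m else b m)
              (Y [set x in i]))))%:E).
  rewrite -sumEFin; apply: eq_bigr => z _.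
  (* A labelling of probability 0 contributes 0 even if its likelihood vanishes, as
     [0 * -oo = 0]. *)
  have := qlaw_ge0 htau z; rewrite le0r => /predU1P[->|z0].
    by rewrite mul0e mul0r.
  by have [l0 <-] := lik z z0; rewrite lne_EFin.
congr (_%:E); under eq_bigr => z _ do rewrite mulrDr.
rewrite big_split /=; congr (_ + _).
under eq_bigr => z _ do rewrite mulr_sumr.
rewrite exchange_big; apply: eq_bigr => m _.
exact: (expect_edges m
  (fun c y => ln (bernoulli_pmf (if c then a m else b m) y))).
Qed.

(** A single labelling of positive probability and zero likelihood would make the expectation [-oo],
    the entropy being finite. So each such likelihood is positive, and so are all its nonnegative
    factors. *)
Lemma compatible_of_elbo th a b :
    hsbm_valid M th -> affiliation_values M th a b ->
    elbo M Y tau th != -oo%E ->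
  prior_compatible (prior th) /\ compatible a b.
Proof.
move=> [p0 p1 c01 _] thab Jfin.
have bern0 z m : (2 <= m <= M)%N -> forall i : m.-tuple 'I_n,
    0 <= bernoulli_pmf (conn th (map_tuple z i)) (Y [set x in i]).
  by move=> mM i; apply: bernoulli_pmf_ge0; apply: c01.
have lik z : 0 < qlaw tau z -> 0 < joint_lik M Y th z.
  move=> z0; rewrite ltNge; apply/negP => l0; move/eqP: Jfin; apply.
  rewrite /elbo entropyE /qexpect; suff -> : (\sum_z0 (qlaw tau z0)%:E *
      lne (joint_lik M Y th z0)%:E = -oo)%E by [].
  apply/eqP; rewrite esum_eqNy; apply/existsP; exists z => /=.
  by rewrite l0 gt0_muleNy ?lte_fin.
have fact z : 0 < qlaw tau z ->
    0 < \prod_i prior th (z i) /\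
    0 < \prod_(2 <= m < M.+1) \prod_(i : m.-tuple 'I_n | increasing i)
      bernoulli_pmf (conn th (map_tuple z i)) (Y [set x in i]).
  move=> /lik; rewrite /joint_lik => l0.
  have P0 : 0 <= \prod_i prior th (z i) by apply: prodr_ge0.
  have P1 : 0 < \prod_i prior th (z i).
    by rewrite lt0r P0 andbT; apply: contraTneq l0 => ->; rewrite mul0r ltxx.
  by split=> //; rewrite -(pmulr_rgt0 _ P1).
split=> z z0.
  move=> i; have [/prodr_gt0_factor P _] := fact z z0.
  by apply: P => //; rewrite mem_index_enum.
move=> m mM i ii v; rewrite /v -thab //; split; first exact: c01.
have [_ /prodr_gt0_factor P] := fact z z0.
apply: (@prodr_gt0_factor _ _ (index_enum _) (@increasing n m) (fun j =>
  bernoulli_pmf (conn th (map_tuple z j)) (Y [set x in j]))) => //.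
- by move=> j _ _; apply: bern0.
- apply: P => //; last by rewrite mem_index_iota ltnS.
  move=> k; rewrite mem_index_iota ltnS => kM _.
  by apply: prodr_ge0 => j _; apply: bern0.
Qed.

Lemma weight_gt0 z m (i : m.-tuple 'I_n) : 0 < qlaw tau z -> increasing i ->
  0 < weight m (constant (map_tuple z i)) (Y [set x in i]).
Proof.
move=> z0 ii; rewrite /weight (bigD1 i) /=; last by rewrite ii eqxx.
rewrite ltr_pwDl //; last first.
  by do 2!(apply: sumr_ge0 => ? _); apply: qlaw_ge0.
rewrite (bigD1 z) //= ltr_pwDl //.
by apply: sumr_ge0 => ? _; apply: qlaw_ge0.
Qed.

Lemma group_weight_gt0 z i : 0 < qlaw tau z -> 0 < group_weight (z i).
Proof.
move=> z0; rewrite /group_weight (bigD1 i) //= ltr_pwDl //; last first.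
  by do 2!(apply: sumr_ge0 => ? _); apply: qlaw_ge0.
rewrite (bigD1 z) //= ltr_pwDl //.
by apply: sumr_ge0 => ? _; apply: qlaw_ge0.
Qed.

(** A positive weight contains a positive term, hence a labelling and a node tuple at which
    compatibility applies. *)
Lemma weight_compatible a b m : compatible a b -> (2 <= m <= M)%N ->
  forall c y, let v := if c then a m else b m in
  0 < weight m c y -> 0 <= v <= 1 /\ 0 < bernoulli_pmf v y.
Proof.
move=> cab mM c y v /lt0r_neq0/eqP.
case/psumr_neq0P => [i _|i /andP[/andP[ii /eqP yi] /lt0r_neq0/eqP]].
  by apply: sumr_ge0 => ? _; apply: qlaw_ge0.
case/psumr_neq0P => [z _|z /andP[/eqP zc z0]]; first exact: qlaw_ge0.
by have := cab z z0 m mM i ii; rewrite zc yi.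
Qed.

Lemma group_weight_compatible p q : prior_compatible p ->
  0 < group_weight q -> 0 < p q.
Proof.
move=> cp /lt0r_neq0/eqP.
case/psumr_neq0P => [i _|i /andP[_ /lt0r_neq0/eqP]].
  by apply: sumr_ge0 => ? _; apply: qlaw_ge0.
case/psumr_neq0P => [z _|z /andP[/eqP zq z0]]; first exact: qlaw_ge0.
by rewrite -zq; apply: cp.
Qed.

Lemma optimal_prior : (1 <= Q)%N -> exists p : 'I_Q -> R,
  [/\ forall q, 0 <= p q, \sum_q p q = 1, prior_compatible p &
    forall p', (forall q, 0 <= p' q) -> \sum_q p' q = 1 -> prior_compatible p' ->
      \sum_q group_weight q * ln (p' q) <= \sum_q group_weight q * ln (p q)].
Proof.
move=> hQ; have [W0|WN0] := eqVneq (\sum_q group_weight q) 0.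
  have Wq q : group_weight q = 0.
    by apply: (psumr_eq0P _ W0) => // k _; apply: group_weight_ge0.
  (* The total weight vanishes only without nodes; any prior is then optimal, and the uniform one is
     taken. *)
  exists (fun=> Q%:R^-1); split.
  - by move=> q; rewrite invr_ge0 ler0n.
  - rewrite sumr_const card_ord -[LHS]mulr_natl divff //.
    by rewrite pnatr_eq0 -lt0n.
  - by move=> z z0 i; have := group_weight_gt0 i z0; rewrite Wq ltxx.
  - by move=> p' _ _ _; rewrite !big1 // => q _; rewrite Wq mul0r.
have W0 : 0 < \sum_q group_weight q.
  by rewrite lt0r WN0 sumr_ge0 // => q _; apply: group_weight_ge0.
exists (fun q => group_weight q / \sum_q group_weight q); split.
- by move=> q; rewrite divr_ge0 ?group_weight_ge0 // ltW.
- by rewrite -mulr_suml divff.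
- by move=> z z0 i; rewrite divr_gt0 // group_weight_gt0.
move=> p' p0 p1 cp; apply: gibbs => // q; first exact: group_weight_ge0.
exact: group_weight_compatible.
Qed.

(** [A] encodes the submodel. The bound is a prior term plus an edge term plus a constant, and the
    two terms are maximized separately. The prior term of another maximizer is at most the optimal
    one, so its edge term must reach the optimum. *)
Lemma maximizer_criterion (D : hsbm_param R Q -> Prop)
    (A : (nat -> R) -> (nat -> R) -> Prop) (ah bh : nat -> R) :
    (1 <= Q)%N ->
    (forall th, D th <-> hsbm_valid M th /\
       exists a b, A a b /\ affiliation_values M th a b) ->
    A ah bh -> (forall m, 0 <= ah m <= 1) -> (forall m, 0 <= bh m <= 1) ->
    compatible ah bh ->
    (forall a b, A a b -> compatible a b -> edge_ll a b <= edge_ll ah bh) ->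
  (exists th, maximizes D (elbo M Y tau) th /\ affiliation_values M th ah bh) /\
  (forall th a b, maximizes D (elbo M Y tau) th -> affiliation_values M th a b ->
     compatible a b /\ edge_ll ah bh <= edge_ll a b).
Proof.
move=> hQ hD Ah ah01 bh01 ch hmax.
have [p [p0 p1 cp pmax]] := optimal_prior hQ.
pose th := HSBM p (fun m (q : m.-tuple 'I_Q) => if constant q then ah m else bh m).
have thah : affiliation_values M th ah bh by [].
have vth : hsbm_valid M th.
  split=> //= m _ q; first by case: ifP.
  by move=> q' qq'; rewrite (constant_perm qq').
have Dth : D th by apply/hD; split=> //; exists ah, bh.
have Jth := elbo_compatible thah cp ch.
split.
  exists th; split=> //; split=> // th' /hD[vth' [a [b [Aab thab]]]].
  have [->|Jfin] := eqVneq (elbo M Y tau th') -oo%E; first exact: leNye.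
  have [cp' cab] := compatible_of_elbo vth' thab Jfin.
  rewrite Jth (elbo_compatible thab cp' cab) lee_fin lerB // lerD ?hmax //.
  by case: vth' => ? ? _ _; apply: pmax.
move=> th' a b [/hD[vth' _] mx] thab; have := mx _ Dth.
(* A maximizer does at least as well as [th], whose bound is finite. *)
have [->|Jfin] := eqVneq (elbo M Y tau th') -oo%E; first by rewrite Jth.
have [cp' cab] := compatible_of_elbo vth' thab Jfin => le.
split=> //; move: le; rewrite Jth (elbo_compatible thab cp' cab) lee_fin lerD2r.
have : \sum_q group_weight q * ln (prior th' q) <= \sum_q group_weight q * ln (p q).
  by case: vth' => ? ? _ _; apply: pmax.
by move=> h1 h2; rewrite /= in h2; lra.
Qed.

End Bound.

(** * Optimal connection values in the two submodels *)

Section Affiliation.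
Context {R : realType} {n Q : nat} (M : nat).
Context (Y : hypergraph n) (tau : 'I_n -> 'I_Q -> R).
Hypothesis htau : variational tau.
Local Notation w := (weight Y tau).

Definition freq_m (c : bool) (m : nat) : R := w m c true / (w m c true + w m c false).

Lemma freq_m_compatible : compatible M Y tau (freq_m true) (freq_m false).
Proof.
move=> z z0 m mM i ii; rewrite (_ : (if _ then _ else _) =
  freq_m (constant (map_tuple z i)) m); last by case: constant.
split; first by apply: freq_bounds; apply: weight_ge0.
apply: bernoulli_freq_gt0; try exact: weight_ge0.
by have := weight_gt0 Y htau z0 ii; case: (Y _).
Qed.

Lemma bern_ll_freq_m a b m (c : bool) (v := if c then a m else b m) :
    compatible M Y tau a b -> (2 <= m <= M)%N ->
  bern_ll (w m c true) (w m c false) v <=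
  bern_ll (w m c true) (w m c false) (freq_m c m)
    ?= iff ((w m c true + w m c false != 0) ==> (v == freq_m c m)).
Proof.
move=> cab mM; have H := weight_compatible htau cab mM (c := c).
apply: bern_ll_max; try exact: weight_ge0.
(* One of the two weights is positive, and either one yields the range of [v]. *)
- move=> W0; case: (ltrP 0 (w m c true)) => [/H[]//|w1].
  have /H[] : 0 < w m c false by lra.
  by [].
- by move=> /H[_].
- by move=> /H[_]; rewrite /= subr_gt0.
Qed.

Definition total_weight c y : R := \sum_(2 <= m < M.+1) w m c y.
Local Notation W := total_weight.

Lemma total_weight_ge0 c y : 0 <= W c y.
Proof. by apply: sumr_ge0 => m _; apply: weight_ge0. Qed.

Definition freq (c : bool) : R := W c true / (W c true + W c false).

Lemma sum_weight_gt0 c y : 0 < W c y ->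
  exists2 m, (2 <= m <= M)%N & 0 < w m c y.
Proof.
move=> /lt0r_neq0; rewrite psumr_neq0 => [/hasP[m]|m _]; last exact: weight_ge0.
by rewrite mem_index_iota ltnS => mM /= w0; exists m.
Qed.

Lemma weight_le_sum m c y : (2 <= m <= M)%N -> w m c y <= W c y.
Proof.
move=> mM; rewrite /total_weight (big_rem m) ?mem_index_iota ?ltnS //= lerDl.
by apply: sumr_ge0 => k _; apply: weight_ge0.
Qed.

Lemma freq_compatible : compatible M Y tau (fun=> freq true) (fun=> freq false).
Proof.
move=> z z0 m mM i ii; rewrite (_ : (if _ then _ else _) =
  freq (constant (map_tuple z i))); last by case: constant.
split; first by apply: freq_bounds; apply: total_weight_ge0.
apply: bernoulli_freq_gt0; try exact: total_weight_ge0.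
have := lt_le_trans (weight_gt0 Y htau z0 ii) (weight_le_sum _ _ mM).
by case: (Y _).
Qed.

Lemma bern_ll_freq a b (c : bool) (v := if c then a else b) :
    compatible M Y tau (fun=> a) (fun=> b) ->
  bern_ll (W c true) (W c false) v <= bern_ll (W c true) (W c false) (freq c)
    ?= iff ((W c true + W c false != 0) ==> (v == freq c)).
Proof.
move=> cab; have H y : 0 < W c y -> 0 <= v <= 1 /\ 0 < bernoulli_pmf v y.
  by move=> /sum_weight_gt0[m mM]; apply: (weight_compatible htau cab mM).
apply: bern_ll_max; try exact: total_weight_ge0.
- move=> W0; case: (ltrP 0 (W c true)) => [/H[]//|w1].
  have /H[] : 0 < W c false by lra.
  by [].
- by move=> /H[_].
- by move=> /H[_]; rewrite /= subr_gt0.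
Qed.

(** [bern_ll] is linear in its weights, so values shared by all sizes see only the summed weights:
    one Bernoulli problem per class remains. *)
Lemma edge_ll_const a b : edge_ll M Y tau (fun=> a) (fun=> b) =
  bern_ll (W true true) (W true false) a + bern_ll (W false true) (W false false) b.
Proof.
rewrite /edge_ll big_split /=; congr (_ + _);
  by rewrite big_split /= /bern_ll -!mulr_suml.
Qed.

Lemma edge_ll_freq_m a b : compatible M Y tau a b ->
  edge_ll M Y tau a b <= edge_ll M Y tau (freq_m true) (freq_m false).
Proof.
move=> cab; rewrite /edge_ll big_seq [leRHS]big_seq; apply: ler_sum => m.
rewrite mem_index_iota ltnS => mM.
by apply: lerD; [apply: (bern_ll_freq_m true cab mM)
                |apply: (bern_ll_freq_m false cab mM)].
Qed.

(** The nonnegative gaps to the optimum have a sum at most 0, so each vanishes and the equality case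
    of Gibbs' inequality applies. *)
Lemma edge_ll_freq_m_eq a b : compatible M Y tau a b ->
    edge_ll M Y tau (freq_m true) (freq_m false) <= edge_ll M Y tau a b ->
  forall m, (2 <= m <= M)%N -> forall c : bool,
    w m c true + w m c false != 0 -> (if c then a m else b m) = freq_m c m.
Proof.
move=> cab; rewrite -subr_le0 /edge_ll -sumrB => le m mM.
pose gap (k : nat) (c : bool) := bern_ll (w k c true) (w k c false) (freq_m c k) -
  bern_ll (w k c true) (w k c false) (if c then a k else b k).
have gap0 k c : (2 <= k <= M)%N -> 0 <= gap k c.
  by move=> kM; rewrite subr_ge0; apply: (bern_ll_freq_m c cab kM).
have gapm c : gap m c <= 0.
  apply: le_trans le; rewrite (big_rem m) ?mem_index_iota ?ltnS //=.
  rewrite opprD addrACA -/(gap m true) -/(gap m false).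
  apply: ler_wpDr.
    rewrite big_seq; apply: sumr_ge0 => k /mem_rem.
    rewrite mem_index_iota ltnS => kM.
    by rewrite opprD addrACA addr_ge0 // ?(gap0 k true) ?(gap0 k false).
  by case: c; rewrite ?lerDl ?lerDr gap0.
move=> c WN0; have := gapm c; rewrite subr_le0.
rewrite (ge_leif (bern_ll_freq_m c cab mM)) WN0 /=.
by move/eqP.
Qed.

Lemma edge_ll_freq a b : compatible M Y tau (fun=> a) (fun=> b) ->
  edge_ll M Y tau (fun=> a) (fun=> b) <=
  edge_ll M Y tau (fun=> freq true) (fun=> freq false).
Proof.
move=> cab; rewrite !edge_ll_const.
by apply: lerD; [apply: (bern_ll_freq true cab)
                |apply: (bern_ll_freq false cab)].
Qed.

Lemma edge_ll_freq_eq a b : compatible M Y tau (fun=> a) (fun=> b) ->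
    edge_ll M Y tau (fun=> freq true) (fun=> freq false) <=
    edge_ll M Y tau (fun=> a) (fun=> b) ->
  forall c : bool, W c true + W c false != 0 -> (if c then a else b) = freq c.
Proof.
move=> cab; rewrite !edge_ll_const.
have lt := bern_ll_freq true cab; have lf := bern_ll_freq false cab.
rewrite (ge_leif (leifD lt lf)) => /andP[et ef] c WN0.
by apply/eqP; case: c WN0 => WN0; [move: et|move: ef]; rewrite WN0.
Qed.

Lemma freq_m_alphaE m : (0 < m)%N ->
  freq_m true m = alpha_num Y tau m / alpha_den tau m.
Proof. by move=> m0; rewrite alpha_numE // (alpha_denE Y). Qed.

Lemma freq_m_betaE m : freq_m false m = beta_num Y tau m / beta_den tau m.
Proof. by rewrite beta_numE // (beta_denE Y). Qed.

Lemma sum_alphaE :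
  \sum_(2 <= m < M.+1) alpha_num Y tau m = W true true /\
  \sum_(2 <= m < M.+1) alpha_den tau m = W true true + W true false.
Proof.
split; rewrite -?big_split; apply: eq_big_nat => m /andP[/ltnW m2 _] /=.
  exact: alpha_numE.
exact: alpha_denE.
Qed.

Lemma sum_betaE :
  \sum_(2 <= m < M.+1) beta_num Y tau m = W false true /\
  \sum_(2 <= m < M.+1) beta_den tau m = W false true + W false false.
Proof.
split; rewrite -?big_split; apply: eq_bigr => m _ /=; first exact: beta_numE.
exact: beta_denE.
Qed.

End Affiliation.

(* In each part: the stated values are attained by a maximizer, and they are
   the only optimal ones as soon as the corresponding denominator is nonzero.
   When a denominator vanishes, the lower bound does not depend on that
   parameter, and [x / 0 = 0] is one optimal value among others. *)
Theorem proposition6 (R : realType) (n Q M : nat)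
    (hQ : (1 <= Q)%N) (hM : (2 <= M)%N)
    (Y : hypergraph n) (tau : 'I_n -> 'I_Q -> R) (htau : variational tau) :
  ((exists th : hsbm_param R Q,
      maximizes (aff_m M) (elbo M Y tau) th /\
      affiliation_values M th
        (fun m => alpha_num Y tau m / alpha_den tau m)
        (fun m => beta_num Y tau m / beta_den tau m)) /\
   (forall (th : hsbm_param R Q) (alpha beta : nat -> R),
      maximizes (aff_m M) (elbo M Y tau) th ->
      affiliation_values M th alpha beta ->
      forall m, (2 <= m <= M)%N ->
        (alpha_den tau m != 0 -> alpha m = alpha_num Y tau m / alpha_den tau m) /\
        (beta_den tau m != 0 -> beta m = beta_num Y tau m / beta_den tau m)))
  /\
  ((exists th : hsbm_param R Q,
      maximizes (aff M) (elbo M Y tau) th /\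
      affiliation_values M th
        (fun=> (\sum_(2 <= m < M.+1) alpha_num Y tau m)
               / (\sum_(2 <= m < M.+1) alpha_den tau m))
        (fun=> (\sum_(2 <= m < M.+1) beta_num Y tau m)
               / (\sum_(2 <= m < M.+1) beta_den tau m))) /\
   (forall (th : hsbm_param R Q) (alpha beta : R),
      maximizes (aff M) (elbo M Y tau) th ->
      affiliation_values M th (fun=> alpha) (fun=> beta) ->
      (\sum_(2 <= m < M.+1) alpha_den tau m != 0 ->
         alpha = (\sum_(2 <= m < M.+1) alpha_num Y tau m)
                 / (\sum_(2 <= m < M.+1) alpha_den tau m)) /\
      (\sum_(2 <= m < M.+1) beta_den tau m != 0 ->
         beta = (\sum_(2 <= m < M.+1) beta_num Y tau m)
                / (\sum_(2 <= m < M.+1) beta_den tau m)))).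
Proof.
split.
  (* Under (Aff-m) the sequences of values are free. *)
  have crit := @maximizer_criterion R n Q M Y tau htau (aff_m M)
    (fun _ _ => True) (freq_m Y tau true) (freq_m Y tau false) hQ.
  case: crit => [||||||ex un].
  - move=> th; split=> -[vth [a [b]]].
      by move=> thab; split=> //; exists a, b.
    by case=> _ thab; split=> //; exists a, b.
  - by [].
  - by move=> m; apply: freq_bounds; apply: weight_ge0.
  - by move=> m; apply: freq_bounds; apply: weight_ge0.
  - exact: freq_m_compatible.
  - by move=> a b _; apply: edge_ll_freq_m.
  split.
    have [th [mx thab]] := ex; exists th; split=> // m mM q.
    rewrite thab // -freq_m_betaE // -freq_m_alphaE //.
    by case/andP: mM => /ltnW.
  move=> th a b mx thab m mM; have [cab le] := un th a b mx thab.
  have eqf := edge_ll_freq_m_eq htau cab le mM.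
  have m0 : (0 < m)%N by case/andP: mM => /ltnW.
  rewrite (alpha_denE Y) // (beta_denE Y) // alpha_numE // beta_numE //.
  by split; [apply: (eqf true)|apply: (eqf false)].
have [-> ->] := sum_alphaE M Y htau; have [-> ->] := sum_betaE M Y htau.
(* Under (Aff) the sequences are restricted to constant ones. *)
have crit := @maximizer_criterion R n Q M Y tau htau (aff M)
  (fun a b => exists x y, a = (fun=> x) /\ b = (fun=> y))
  (fun=> freq M Y tau true) (fun=> freq M Y tau false) hQ.
case: crit => [||||||ex un].
- move=> th; split=> -[vth [a [b]]].
    by move=> thab; split=> //; exists (fun=> a), (fun=> b); split=> //; exists a, b.
  by case=> -[x [y [-> ->]]] thab; split=> //; exists x, y.
- by exists (freq M Y tau true), (freq M Y tau false).
- by move=> m; apply: freq_bounds; apply: sumr_ge0 => k _; apply: weight_ge0.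
- by move=> m; apply: freq_bounds; apply: sumr_ge0 => k _; apply: weight_ge0.
- exact: freq_compatible.
- by move=> a b [x [y [-> ->]]]; apply: edge_ll_freq.
split; first exact: ex.
move=> th a b mx thab; have [cab le] := un th _ _ mx thab.
have eqf := edge_ll_freq_eq htau cab le.
by split; [apply: (eqf true)|apply: (eqf false)].
Qed.
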